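(* Let $(\mathscr{K},\otimes,1)$ be a non-zero tensor triangulated category. (a) Let $\mathscr{S}$ be a $\otimes$-multiplicative collection of objects of $\mathscr{K}$ which does not contain zero. Then there exists a prime $\mathscr{P}\in\operatorname{Spc}(\mathscr{K})$ such that $\mathscr{P}\cap\mathscr{S}=\varnothing$. (b) Let $\mathscr{J}\subsetneq\mathscr{K}$ be a proper thick $\otimes$-ideal. Then there exists a maximal proper thick $\otimes$-ideal $\mathscr{M}\subsetneq\mathscr{K}$ which contains $\mathscr{J}$. (c) Maximal proper thick $\otimes$-ideals are prime. (d) The spectrum of $\mathscr{K}$ is not empty: $\operatorname{Spc}(\mathscr{K})\neq\varnothing$.
   Context: All categories are essentially small. A tensor triangulated category $(\mathscr{K},\otimes,1)$ is a triangulated category $\mathscr{K}$ (translation functor $T$) with a symmetric monoidal product $\otimes:\mathscr{K}\times\mathscr{K}\to\mathscr{K}$ which is exact in each variable, with unit $1$. A thick $\otimes$-ideal of $\mathscr{K}$ is a full subcategory $\mathscr{A}$ containing $0$ such that: (a) for any distinguished triangle $a\to b\to c\to Ta$, if two of $a,b,c$ belong to $\mathscr{A}$ then so does the third; (b) if $a\in\mathscr{A}$ and $a\simeq b\oplus c$ in $\mathscr{K}$ then $b,c\in\mathscr{A}$; (c) if $a\in\mathscr{A}$ and $b\in\mathscr{K}$ then $a\otimes b\in\mathscr{A}$. Thick $\otimes$-ideals are closed under isomorphism; ''contains zero'' means contains a zero object. A prime of $\mathscr{K}$ is a thick $\otimes$-ideal $\mathscr{P}\subsetneq\mathscr{K}$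 such that $a\otimes b\in\mathscr{P}$ implies $a\in\mathscr{P}$ or $b\in\mathscr{P}$. $\operatorname{Spc}(\mathscr{K})$ is the set of all primes of $\mathscr{K}$. A collection of objects $\mathscr{S}$ is $\otimes$-multiplicative if $1\in\mathscr{S}$ and $a_1,a_2\in\mathscr{S}$ implies $a_1\otimes a_2\in\mathscr{S}$. *)

(* Defs.v *)
From mathcomp Require Import all_boot all_algebra.
From mathcomp Require Import boolp classical_sets.

Set Implicit Arguments.
Unset Strict Implicit.
Unset Printing Implicit Defensive.

Import GRing.Theory.
Local Open Scope classical_set_scope.
Local Open Scope ring_scope.

Declare Scope cat_scope.
Delimit Scope cat_scope with cat.

(* The objects form a type and morphisms are compared with Leibniz equality,
   so each of these categories is small relative to a larger universe. *)
Record preadditive := Preadditive {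
  obj :> Type;
  hom : obj -> obj -> zmodType;
  idm : forall a, hom a a;
  compm : forall a b c, hom b c -> hom a b -> hom a c;
  compm1 : forall a b (f : hom a b), compm f (idm a) = f;
  comp1m : forall a b (f : hom a b), compm (idm b) f = f;
  compmA : forall a b c d (h : hom c d) (g : hom b c) (f : hom a b),
    compm h (compm g f) = compm (compm h g) f;
  compmDl : forall a b c (g g' : hom b c) (f : hom a b),
    compm (g + g') f = compm g f + compm g' f;
  compmDr : forall a b c (g : hom b c) (f f' : hom a b),
    compm g (f + f') = compm g f + compm g f'
}.
Arguments hom {p} a b.
Arguments idm {p} a.
Arguments compm {p a b c} g f.
Notation "g \o f" := (compm g f) : cat_scope.
Local Open Scope cat_scope.

Definition is_iso (C : preadditive) (a b : C) (f : hom a b) : Prop :=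
  exists g : hom b a, g \o f = idm a /\ f \o g = idm b.

Definition isomorphic (C : preadditive) (a b : C) : Prop :=
  exists f : hom a b, is_iso f.

Definition is_zero (C : preadditive) (z : C) : Prop :=
  (forall a : C, exists! f : hom z a, True) /\
  (forall a : C, exists! f : hom a z, True).

Record additive := Additive {
  add_pre :> preadditive;
  has_zero : exists z : add_pre, is_zero z;
  dsum : add_pre -> add_pre -> add_pre;
  inj1 : forall a b, hom a (dsum a b);
  inj2 : forall a b, hom b (dsum a b);
  prj1 : forall a b, hom (dsum a b) a;
  prj2 : forall a b, hom (dsum a b) b;
  prj1_inj1 : forall a b, prj1 a b \o inj1 a b = idm a;
  prj2_inj2 : forall a b, prj2 a b \o inj2 a b = idm b;
  prj1_inj2 : forall a b, prj1 a b \o inj2 a b = 0;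
  prj2_inj1 : forall a b, prj2 a b \o inj1 a b = 0;
  inj_prj : forall a b,
    (inj1 a b \o prj1 a b) + (inj2 a b \o prj2 a b) = idm (dsum a b)
}.
Arguments dsum {a} _ _ : rename.
Notation "a \oplus b" := (dsum a b)
  (at level 50, left associativity) : cat_scope.

Record functor (C D : preadditive) := Functor {
  fobj :> C -> D;
  fmap : forall a b, hom a b -> hom (fobj a) (fobj b);
  fmap1 : forall a, fmap (idm a) = idm (fobj a);
  fmapM : forall a b c (g : hom b c) (f : hom a b),
    fmap (g \o f) = fmap g \o fmap f
}.
Arguments fmap {C D} F {a b} f : rename.

Definition functor_id (C : preadditive) : functor C C.
Proof. by exists id (fun a b f => f). Defined.

Definition functor_comp (C D E : preadditive) (G : functor D E)
  (F : functor C D) : functor C E.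
Proof.
exists (fun a => G (F a)) (fun a b f => fmap G (fmap F f)).
- by move=> a; rewrite !fmap1.
- by move=> a b c g f; rewrite !fmapM.
Defined.

Definition is_nat_iso (C D : preadditive) (F G : functor C D)
  (t : forall a, hom (F a) (G a)) : Prop :=
  (forall a, is_iso (t a)) /\
  (forall a b (f : hom a b), t b \o fmap F f = fmap G f \o t a).

Definition is_equivalence (C D : preadditive) (F : functor C D) : Prop :=
  exists G : functor D C,
    (exists t, @is_nat_iso _ _ (functor_comp G F) (functor_id C) t) /\
    (exists t, @is_nat_iso _ _ (functor_comp F G) (functor_id D) t).

Definition is_additive (C D : preadditive) (F : functor C D) : Prop :=
  forall a b (f g : hom a b), fmap F (f + g) = fmap F f + fmap F g.

(* Verdier's axioms; the translation is allowed to be any additive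
   self-equivalence, not only an automorphism. TR1 is dist_iso, dist_id and
   dist_cone, and the octahedron dist_oct has the edges u : d -> w and
   v : w -> e between the cones d of f, w of g \o f and e of g. *)
Record triangulated := Triangulated {
  tri_add :> additive;
  shift : functor tri_add tri_add;
  shift_additive : is_additive shift;
  shift_equivalence : is_equivalence shift;
  dist : forall a b c : tri_add,
    hom a b -> hom b c -> hom c (shift a) -> Prop;
  dist_iso : forall (a b c a' b' c' : tri_add)
    (f : hom a b) (g : hom b c) (h : hom c (shift a))
    (f' : hom a' b') (g' : hom b' c') (h' : hom c' (shift a'))
    (u : hom a a') (v : hom b b') (w : hom c c'),
    is_iso u -> is_iso v -> is_iso w ->
    v \o f = f' \o u -> w \o g = g' \o v -> fmap shift u \o h = h' \o w ->
    dist f g h -> dist f' g' h';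
  dist_id : forall a z : tri_add, is_zero z ->
    dist (idm a) (0 : hom a z) (0 : hom z (shift a));
  dist_cone : forall (a b : tri_add) (f : hom a b),
    exists (c : tri_add) (g : hom b c) (h : hom c (shift a)), dist f g h;
  dist_rot : forall (a b c : tri_add)
    (f : hom a b) (g : hom b c) (h : hom c (shift a)),
    dist f g h <-> dist g h (- fmap shift f);
  dist_morph : forall (a b c a' b' c' : tri_add)
    (f : hom a b) (g : hom b c) (h : hom c (shift a))
    (f' : hom a' b') (g' : hom b' c') (h' : hom c' (shift a'))
    (u : hom a a') (v : hom b b'),
    dist f g h -> dist f' g' h' -> v \o f = f' \o u ->
    exists w : hom c c', w \o g = g' \o v /\ fmap shift u \o h = h' \o w;
  dist_oct : forall (a b c d e w : tri_add)
    (f : hom a b) (f1 : hom b d) (f2 : hom d (shift a))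
    (g : hom b c) (g1 : hom c e) (g2 : hom e (shift b))
    (k1 : hom c w) (k2 : hom w (shift a)),
    dist f f1 f2 -> dist g g1 g2 -> dist (g \o f) k1 k2 ->
    exists (u : hom d w) (v : hom w e),
      [/\ dist u v (fmap shift f1 \o g2),
          u \o f1 = k1 \o g, k2 \o u = f2,
          v \o k1 = g1 & g2 \o v = fmap shift f \o k2]
}.
Arguments shift {t}.
Arguments dist {t a b c} f g h.

Definition is_exact (K L : triangulated) (F : functor K L) : Prop :=
  is_additive F /\
  exists t : forall a, hom (F (shift a)) (shift (F a)),
    @is_nat_iso _ _ (functor_comp F shift) (functor_comp shift F) t /\
    forall (a b c : K) (f : hom a b) (g : hom b c) (h : hom c (shift a)),
      dist f g h -> dist (fmap F f) (fmap F g) (t a \o fmap F h).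

(* The second hexagon and the unit coherences of the braiding follow from
   these axioms. *)
Record sym_monoidal (C : preadditive) := SymMonoidal {
  tens : C -> C -> C;
  tensm : forall a a' b b',
    hom a a' -> hom b b' -> hom (tens a b) (tens a' b');
  tensm1 : forall a b, tensm (idm a) (idm b) = idm (tens a b);
  tensmM : forall a a' a'' b b' b''
    (f' : hom a' a'') (f : hom a a') (g' : hom b' b'') (g : hom b b'),
    tensm (f' \o f) (g' \o g) = tensm f' g' \o tensm f g;
  unit_ob : C;
  assoc : forall a b c, hom (tens (tens a b) c) (tens a (tens b c));
  lunit : forall a, hom (tens unit_ob a) a;
  runit : forall a, hom (tens a unit_ob) a;
  braid : forall a b, hom (tens a b) (tens b a);
  assoc_iso : forall a b c, is_iso (assoc a b c);
  lunit_iso : forall a, is_iso (lunit a);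
  runit_iso : forall a, is_iso (runit a);
  assoc_nat : forall a a' b b' c c'
    (f : hom a a') (g : hom b b') (h : hom c c'),
    assoc a' b' c' \o tensm (tensm f g) h
    = tensm f (tensm g h) \o assoc a b c;
  lunit_nat : forall a a' (f : hom a a'),
    lunit a' \o tensm (idm unit_ob) f = f \o lunit a;
  runit_nat : forall a a' (f : hom a a'),
    runit a' \o tensm f (idm unit_ob) = f \o runit a;
  braid_nat : forall a a' b b' (f : hom a a') (g : hom b b'),
    braid a' b' \o tensm f g = tensm g f \o braid a b;
  pentagon : forall a b c d,
    assoc a b (tens c d) \o assoc (tens a b) c d
    = tensm (idm a) (assoc b c d) \o assoc a (tens b c) d
      \o tensm (assoc a b c) (idm d);
  triangle : forall a b,
    tensm (idm a) (lunit b) \o assoc a unit_ob b = tensm (runit a) (idm b);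
  hexagon : forall a b c,
    assoc b c a \o braid a (tens b c) \o assoc a b c
    = tensm (idm b) (braid a c) \o assoc b a c
      \o tensm (braid a b) (idm c);
  symmetry : forall a b, braid b a \o braid a b = idm (tens a b)
}.

Definition tens_left (C : preadditive) (M : sym_monoidal C) (a : C) :
  functor C C.
Proof.
exists (fun b => tens M a b) (fun b b' g => tensm M (idm a) g).
- by move=> b; rewrite tensm1.
- by move=> b b' b'' g f; rewrite -tensmM compm1.
Defined.

Definition tens_right (C : preadditive) (M : sym_monoidal C) (b : C) :
  functor C C.
Proof.
exists (fun a => tens M a b) (fun a a' f => tensm M f (idm b)).
- by move=> a; rewrite tensm1.
- by move=> a a' a'' g f; rewrite -tensmM compm1.
Defined.

(* Exactness is imposed on each variable separately; no compatibility between
   the two isomorphisms with the shift is required. *)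
Record tt_category := TTCategory {
  tt_tri :> triangulated;
  tt_mon : sym_monoidal tt_tri;
  tens_left_exact : forall a, is_exact (tens_left tt_mon a);
  tens_right_exact : forall b, is_exact (tens_right tt_mon b)
}.
Arguments tt_mon {t}.
Notation "a \otimes b" := (tens tt_mon a b)
  (at level 40, left associativity) : cat_scope.

Definition nonzero_category (K : preadditive) : Prop :=
  exists a : K, ~ is_zero a.

(* Full subcategories are represented by their sets of objects. *)
Record thick_ideal (K : tt_category) (A : set K) : Prop := ThickIdeal {
  thick_zero : exists2 z : K, is_zero z & A z;
  thick_tri : forall (a b c : K) (f : hom a b) (g : hom b c)
    (h : hom c (shift a)), dist f g h ->
    [/\ A a -> A b -> A c, A a -> A c -> A b & A b -> A c -> A a];
  thick_summand : forall a b c : K,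
    A a -> isomorphic a (b \oplus c) -> A b /\ A c;
  thick_tens : forall a b : K, A a -> A (a \otimes b)
}.

Definition proper_thick_ideal (K : tt_category) (A : set K) : Prop :=
  thick_ideal A /\ A `<` setT.

Definition prime_thick_ideal (K : tt_category) (P : set K) : Prop :=
  proper_thick_ideal P /\ forall a b : K, P (a \otimes b) -> P a \/ P b.

Definition Spc (K : tt_category) : set (set K) :=
  [set P | prime_thick_ideal P].
Arguments Spc K : clear implicits.

Definition maximal_thick_ideal (K : tt_category) (M : set K) : Prop :=
  proper_thick_ideal M /\
  forall N : set K, proper_thick_ideal N -> M `<=` N -> N = M.

Definition tens_multiplicative (K : tt_category) (S : set K) : Prop :=
  S (unit_ob (@tt_mon K)) /\ forall a b : K, S a -> S b -> S (a \otimes b).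

(* Main.v *)
From mathcomp Require Import all_boot all_algebra.
From mathcomp Require Import boolp.
Import GRing.Theory.
Require Import Defs.
From mathcomp Require Import classical_sets.
Local Open Scope ring_scope.
Local Open Scope cat_scope.
Local Open Scope classical_set_scope.

Set Implicit Arguments.
Unset Strict Implicit.
Unset Printing Implicit Defensive.

(** The argument is that of commutative algebra.  By Zorn's lemma every thick
    ideal that misses a set [S] of objects lies in one that is maximal for this
    property ([exists_maximal_disjoint_thick]), since thick ideals are stable
    under unions of chains.  The key point ([maximal_disjoint_prime]) is that
    such a maximal [P] is prime as soon as [S] is multiplicative.  It rests on
    the quotient ideals [(P : b)] of objects [x] with [x \otimes b] in [P],
    which are thick because tensoring with [b] is exact: if [a \otimes b] is in
    [P] while neither [a] nor [b] is, then [(P : b)] contains [P] and [a],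
    hence some [s] in [S] by maximality; now [(P : s)] contains [P] and [b],
    hence some [t] in [S], and [t \otimes s] lies both in [P] and in [S].  No
    description of the thick ideal generated by an object is needed.

    For (a), this is applied above the ideal of zero objects, which is thick
    ([zero_thick]).  For the other parts, [S] is taken to be the isomorphism
    class of the unit, which is multiplicative: a thick ideal is proper exactly
    when it misses this class, so the ideals maximal among those disjoint from
    it are the maximal proper ones.  The class contains no zero object, for
    otherwise every [a], being isomorphic to [unit \otimes a], would be zero. *)

(** * Zero objects and isomorphisms in preadditive categories *)

Section Preadditive.
Variable C : preadditive.
Implicit Types a b c z : C.

Lemma comp0m a b c (f : hom a b) : (0 : hom b c) \o f = 0.
Proof. by apply: (addrI ((0 : hom b c) \o f)); rewrite -compmDl !addr0. Qed.

Lemma compm0 a b c (g : hom b c) : g \o (0 : hom a b) = 0.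
Proof. by apply: (addrI (g \o (0 : hom a b))); rewrite -compmDr !addr0. Qed.

Lemma is_zeroE z : is_zero z <-> idm z = 0.
Proof.
split=> [[/(_ z)[f [_ uf]] _]|z0].
  by rewrite -(uf (idm z) I) -(uf 0 I).
split=> a; exists 0; split=> // f _.
  by rewrite -(compm1 f) z0 compm0.
by rewrite -(comp1m f) z0 comp0m.
Qed.

Lemma hom_from_zero z a (f : hom z a) : is_zero z -> f = 0.
Proof. by move=> /is_zeroE z0; rewrite -(compm1 f) z0 compm0. Qed.

Lemma hom_to_zero z a (f : hom a z) : is_zero z -> f = 0.
Proof. by move=> /is_zeroE z0; rewrite -(comp1m f) z0 comp0m. Qed.

Lemma idm_iso a : is_iso (idm a).
Proof. by exists (idm a); rewrite compm1. Qed.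

Lemma isomorphic_refl a : isomorphic a a.
Proof. by exists (idm a); apply: idm_iso. Qed.

Lemma isomorphic_sym a b : isomorphic a b -> isomorphic b a.
Proof. by move=> [f [g [gf fg]]]; exists g, f. Qed.

Lemma isomorphic_trans b a c :
  isomorphic a b -> isomorphic b c -> isomorphic a c.
Proof.
move=> [f [f' [f'f ff']]] [g [g' [g'g gg']]].
exists (g \o f), (f' \o g'); split.
  by rewrite compmA -(compmA f') g'g compm1.
by rewrite compmA -(compmA g) ff' compm1.
Qed.

Lemma isomorphic_is_zero a b : isomorphic a b -> is_zero a -> is_zero b.
Proof.
move=> [f [g [_ fg]]] a0.
by apply/is_zeroE; rewrite -fg (hom_from_zero f a0) comp0m.
Qed.

Lemma is_zero_isomorphic a b : is_zero a -> is_zero b -> isomorphic a b.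
Proof.
move=> a0 b0; exists 0, 0; split.
  by rewrite comp0m (hom_from_zero (idm a) a0).
by rewrite comp0m (hom_from_zero (idm b) b0).
Qed.

End Preadditive.

Lemma fmap_isomorphic (C D : preadditive) (F : functor C D) a b :
  isomorphic a b -> isomorphic (F a) (F b).
Proof.
by move=> [f [g [gf fg]]]; exists (fmap F f), (fmap F g);
  rewrite -!fmapM gf fg !fmap1.
Qed.

Lemma fmap0 (C D : preadditive) (F : functor C D) a b :
  is_additive F -> fmap F (0 : hom a b) = 0.
Proof. by move=> Fadd; apply: (addrI (fmap F (0 : hom a b))); rewrite -Fadd !addr0. Qed.

Lemma fmap_is_zero (C D : preadditive) (F : functor C D) a :
  is_additive F -> is_zero a -> is_zero (F a).
Proof.
by move=> Fadd /is_zeroE a0; apply/is_zeroE; rewrite -fmap1 a0 fmap0.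
Qed.

(** The equality [idm a = 0] becomes true after applying [F]; a quasi-inverse
    of [F], which is not known to be additive, still carries it back by
    naturality. *)
Lemma equivalence_is_zero (C D : preadditive) (F : functor C D) a :
  is_equivalence F -> is_zero (F a) -> is_zero a.
Proof.
move=> [G [[t [t_iso t_nat]] _]] Fa0; apply/is_zeroE.
have [t' [_ tt']] := t_iso a.
have e : fmap F (idm a) = fmap F 0.
  by rewrite [LHS](hom_from_zero _ Fa0) [RHS](hom_from_zero _ Fa0).
have /= t1 := t_nat a a (idm a); have /= t0 := t_nat a a 0.
by rewrite -[LHS]compm1 -{2}tt' compmA -t1 e t0 !comp0m.
Qed.

Lemma fmap_dsum (A B : additive) (F : functor A B) a b :
  is_additive F -> isomorphic (F (a \oplus b)) (F a \oplus F b).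
Proof.
move=> Fadd.
exists ((inj1 _ _ \o fmap F (prj1 a b)) + (inj2 _ _ \o fmap F (prj2 a b))).
exists ((fmap F (inj1 a b) \o prj1 _ _) + (fmap F (inj2 a b) \o prj2 _ _)).
have cancel4 (D : preadditive) (x y z w v : D) (p : hom z w) (q : hom y z)
    (r : hom x y) (s : hom v x) :
    (p \o q) \o (r \o s) = p \o ((q \o r) \o s) by rewrite !compmA.
split; rewrite !compmDl !compmDr !cancel4.
  rewrite prj1_inj1 prj2_inj2 prj1_inj2 prj2_inj1 !comp0m !compm0 !comp1m.
  by rewrite addr0 add0r -!fmapM -Fadd inj_prj fmap1.
rewrite -!fmapM prj1_inj1 prj2_inj2 prj1_inj2 prj2_inj1 !fmap1 !fmap0 //.
by rewrite !comp0m !compm0 !comp1m addr0 add0r inj_prj.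
Qed.

(** * Triangles with two zero vertices *)

Section Triangulated.
Variable K : triangulated.
Implicit Types a b c z : K.

Lemma shift_is_zero a : is_zero (shift a) <-> is_zero a.
Proof.
split; first exact/equivalence_is_zero/shift_equivalence.
exact/fmap_is_zero/shift_additive.
Qed.

(** Such a triangle makes [idm b] factor through [g], by extending the square
    from [f] to [z -> b] to a morphism into the triangle [z -> b -> b]. *)
Lemma dist_mid_zero a b c (f : hom a b) (g : hom b c) (h : hom c (shift a)) :
  dist f g h -> is_zero a -> is_zero c -> is_zero b.
Proof.
move=> fgh a0 c0; have [z z0] := has_zero K.
have zbb : dist (0 : hom z b) (idm b) (0 : hom b (shift z)).
  apply/dist_rot; rewrite fmap0 ?oppr0; last exact: shift_additive.
  exact/dist_id/shift_is_zero.
have [|w [wg _]] := dist_morph (u := 0) (v := idm b) fgh zbb.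
  by rewrite (hom_from_zero f a0) compm0 comp0m.
apply/is_zeroE; move: wg; rewrite compm1 => <-.
by rewrite (hom_to_zero g c0) compm0.
Qed.

Lemma dist_is_zero a b c (f : hom a b) (g : hom b c) (h : hom c (shift a)) :
  dist f g h ->
  [/\ is_zero a -> is_zero b -> is_zero c,
      is_zero a -> is_zero c -> is_zero b
    & is_zero b -> is_zero c -> is_zero a].
Proof.
move=> fgh; have /dist_rot fgh1 := fgh; have /dist_rot fgh2 := fgh1.
split=> [a0 b0|a0 c0|b0 c0].
- by apply: (dist_mid_zero fgh1) => //; apply/shift_is_zero.
- exact: dist_mid_zero fgh a0 c0.
- by apply/shift_is_zero/(dist_mid_zero fgh2) => //; apply/shift_is_zero.
Qed.

(** Carries the triangle of [idm a] along [f]; through the two-out-of-three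
    property it makes thick ideals stable under isomorphism. *)
Lemma dist_iso_zero a b z (f : hom a b) :
  is_iso f -> is_zero z -> dist f (0 : hom b z) (0 : hom z (shift a)).
Proof.
move=> f_iso z0.
apply: (dist_iso (idm_iso a) f_iso (idm_iso z)) (dist_id a z0) => //.
  by rewrite comp0m compm0.
by rewrite comp0m compm0.
Qed.

End Triangulated.

(** * Thick ideals *)

Section Thick.
Variable K : tt_category.
Implicit Types (a b c s t z : K) (A J M P S : set K).

Local Notation unit := (unit_ob (@tt_mon K)).

Lemma tens_isomorphic a a' b b' :
  isomorphic a a' -> isomorphic b b' -> isomorphic (a \otimes b) (a' \otimes b').
Proof.
move=> [f [f' [f'f ff']]] [g [g' [g'g gg']]].
exists (tensm tt_mon f g), (tensm tt_mon f' g').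
by rewrite -!tensmM f'f g'g ff' gg' !tensm1.
Qed.

Lemma assoc_isomorphic a b c :
  isomorphic (a \otimes b \otimes c) (a \otimes (b \otimes c)).
Proof. by exists (assoc tt_mon a b c); apply: assoc_iso. Qed.

Lemma unit_isomorphic a : isomorphic (unit \otimes a) a.
Proof. by exists (lunit tt_mon a); apply: lunit_iso. Qed.

Lemma braid_isomorphic a b : isomorphic (a \otimes b) (b \otimes a).
Proof.
by exists (braid tt_mon a b), (braid tt_mon b a); rewrite !symmetry.
Qed.

Lemma tens_is_zero a b : is_zero a -> is_zero (a \otimes b).
Proof. exact: (fmap_is_zero (proj1 (tens_right_exact b))). Qed.

Lemma thick_isomorphic A a b :
  thick_ideal A -> isomorphic a b -> A a -> A b.
Proof.
move=> At [f f_iso] Aa; have [z z0 Az] := thick_zero At.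
by have [_ /(_ Aa Az)] := thick_tri At (dist_iso_zero f_iso z0).
Qed.

Lemma thick_is_zero A z : thick_ideal A -> is_zero z -> A z.
Proof.
move=> At z0; have [z' z'0 Az'] := thick_zero At.
exact: thick_isomorphic At (is_zero_isomorphic z'0 z0) Az'.
Qed.

Lemma zero_thick : thick_ideal (@is_zero K).
Proof.
split.
- by have [z z0] := has_zero K; exists z.
- by move=> a b c f g h; apply: dist_is_zero.
- move=> a b c a0 /isomorphic_is_zero /(_ a0) bc0.
  split; apply/is_zeroE.
    by rewrite -(prj1_inj1 b c) (hom_to_zero (inj1 b c) bc0) compm0.
  by rewrite -(prj2_inj2 b c) (hom_to_zero (inj2 b c) bc0) compm0.
- exact: tens_is_zero.
Qed.

Definition ideal_quotient P b : set K := [set x | P (x \otimes b)].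

(** The functor [- \otimes b] preserves triangles and direct sums, and
    [(x \otimes y) \otimes b] is isomorphic to [(x \otimes b) \otimes y]. *)
Lemma ideal_quotient_thick P b :
  thick_ideal P -> thick_ideal (ideal_quotient P b).
Proof.
move=> Pt; have [Fadd [t [_ Fdist]]] := tens_right_exact b.
split.
- have [z z0] := has_zero K; exists z => //.
  exact/(thick_is_zero Pt)/tens_is_zero.
- by move=> x y w f g h /Fdist; apply: (thick_tri Pt).
- move=> x y w Px xyw; apply: (thick_summand Pt) Px _.
  apply: isomorphic_trans (fmap_isomorphic (tens_right tt_mon b) xyw) _.
  exact: fmap_dsum.
- move=> x y Px.
  apply: (thick_isomorphic Pt) (thick_tens Pt y Px).
  apply: isomorphic_trans (assoc_isomorphic _ _ _) _.
  apply: isomorphic_trans (isomorphic_sym (assoc_isomorphic _ _ _)).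
  exact: tens_isomorphic (isomorphic_refl _) (braid_isomorphic _ _).
Qed.

Lemma sub_ideal_quotient P b : thick_ideal P -> P `<=` ideal_quotient P b.
Proof. by move=> Pt x Px; apply: thick_tens. Qed.

(** Every closure property involves at most two given members, and two members
    of the union of a chain lie in a common ideal of the chain. *)
Lemma chain_bigcup_thick (F : set (set K)) :
  F !=set0 -> total_on F subset -> (forall A, F A -> thick_ideal A) ->
  thick_ideal (\bigcup_(A in F) A).
Proof.
move=> [A0 FA0] Ftot Ft.
have common a b : (\bigcup_(A in F) A) a -> (\bigcup_(A in F) A) b ->
    exists A, [/\ F A, A a & A b].
  move=> [A FA Aa] [B FB Bb]; have [AB|BA] := Ftot _ _ FA FB.
    by exists B; split => //; apply: AB.
  by exists A; split => //; apply: BA.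
split.
- by have [z z0 Az] := thick_zero (Ft _ FA0); exists z => //; exists A0.
- move=> a b c f g h fgh.
  split=> Ux Uy; have [A [FA Ax Ay]] := common _ _ Ux Uy;
    have [Hc Hb Ha] := thick_tri (Ft _ FA) fgh; exists A => //.
  + exact: Hc.
  + exact: Hb.
  + exact: Ha.
- move=> a b c [A FA Aa] /(thick_summand (Ft _ FA) Aa) [Ab Ac].
  by split; exists A.
- by move=> a b [A FA Aa]; exists A => //; apply: thick_tens (Ft _ FA) _ _ _.
Qed.

(** * Ideals maximal among those that miss a set of objects *)

Definition disjoint_thick S A : Prop := thick_ideal A /\ A `&` S = set0.

Definition maximal_disjoint_thick S P : Prop :=
  disjoint_thick S P /\
  forall A, disjoint_thick S A -> P `<=` A -> A = P.

Lemma exists_maximal_disjoint_thick S J :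
  disjoint_thick S J -> exists P, maximal_disjoint_thick S P /\ J `<=` P.
Proof.
move=> SJ.
(* Ranging over the sets [X] for which [J `|` X] is admissible gives the empty
   chain an upper bound, namely its union [set0]. *)
have [|X [SX Xmax]] := @Zorn_bigcup K [set X | disjoint_thick S (J `|` X)].
  move=> F Fs Ftot /=.
  pose G := [set J `|` X | X in F `|` [set set0]].
  have GS A : G A -> disjoint_thick S A.
    by move=> [X [FX|->] <-]; [apply: Fs | rewrite setU0].
  have -> : J `|` \bigcup_(X in F) X = \bigcup_(A in G) A.
    apply/seteqP; split=> x.
      move=> [Jx|[X FX Xx]].
        by exists (J `|` set0); [exists set0; [right|] | left].
      by exists (J `|` X); [exists X; [left|] | right].
    move=> [_ [X [FX|->] <-] [Jx|Xx]]; [by left| |by left|by []].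
    by right; exists X.
  split.
    apply: chain_bigcup_thick => [||A /GS[]//].
      by exists (J `|` set0), set0; first right.
    move=> _ _ [X FX <-] [Y FY <-].
    have [XY|YX] : X `<=` Y \/ Y `<=` X.
      case: FX FY => [FX|->] [FY|->]; [exact: Ftot|by right|by left|by left].
      by left; apply: setUS.
    by right; apply: setUS.
  apply/seteqP; split=> x // [[A GA Ax] Sx].
  by have [_ <-] := GS _ GA.
exists (J `|` X); split; last exact: subsetUl.
split=> // A SA XA.
apply/seteqP; split=> // x Ax; apply: contrapT => nXx.
have JA : J `|` A = A by apply/setUidPr => y Jy; apply: XA; left.
apply: (Xmax A); last by rewrite /= JA.
split=> [y Xy|AX]; first by apply: XA; right.
by apply: nXx; right; apply: AX.
Qed.

Lemma maximal_disjoint_meets S P A a :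
  maximal_disjoint_thick S P -> thick_ideal A -> P `<=` A -> A a -> ~ P a ->
  exists2 s, A s & S s.
Proof.
move=> [_ Pmax] At PA Aa nPa; apply: contrapT => noS.
apply: nPa; rewrite -(Pmax A) //; split=> //.
by apply/seteqP; split=> // s [As Ss]; apply: noS; exists s.
Qed.

Lemma maximal_disjoint_prime S P :
  tens_multiplicative S -> maximal_disjoint_thick S P -> prime_thick_ideal P.
Proof.
move=> [S1 SM] Pmax; have [[Pt PS] _] := Pmax.
have noPS x : P x -> S x -> False.
  by move=> Px Sx; have : (P `&` S) x by []; rewrite PS.
split.
  by split=> //; split=> [//|/(_ unit I)/noPS]; apply.
move=> a b Pab; apply: contrapT => /not_orP [nPa nPb].
have [s Psb Ss] : exists2 s, ideal_quotient P b s & S s.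
  apply: (maximal_disjoint_meets (a := a) Pmax) => //.
    exact: ideal_quotient_thick.
  exact: sub_ideal_quotient.
have [t Pts St] : exists2 t, ideal_quotient P s t & S t.
  apply: (maximal_disjoint_meets (a := b) Pmax) => //.
  - exact: ideal_quotient_thick.
  - exact: sub_ideal_quotient.
  - exact: thick_isomorphic Pt (braid_isomorphic _ _) Psb.
exact: noPS Pts (SM _ _ St Ss).
Qed.

(** * The isomorphism class of the unit *)

Definition unit_class : set K := [set a | isomorphic a unit].

Lemma unit_class_multiplicative : tens_multiplicative unit_class.
Proof.
split=> [|a b au bu]; first exact: isomorphic_refl.
exact: isomorphic_trans (tens_isomorphic au bu) (unit_isomorphic _).
Qed.

Lemma proper_thick_idealE A :
  proper_thick_ideal A <-> disjoint_thick unit_class A.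
Proof.
split=> [[At [_ nA]]|[At AU]]; split=> //.
  apply/seteqP; split=> // a [Aa au]; apply: nA => b _.
  apply: (thick_isomorphic At) (unit_isomorphic b) _.
  exact/(thick_tens At)/(thick_isomorphic At au).
split=> // TA; have : (A `&` unit_class) unit.
  by split; [apply: TA | apply: isomorphic_refl].
by rewrite AU.
Qed.

Lemma maximal_thick_idealE M :
  maximal_thick_ideal M <-> maximal_disjoint_thick unit_class M.
Proof.
by split=> -[/proper_thick_idealE Mp Mmax];
  split=> // N /proper_thick_idealE; apply: Mmax.
Qed.

Lemma unit_class_nonzero z :
  nonzero_category K -> is_zero z -> ~ unit_class z.
Proof.
move=> [a na] z0 zu; apply: na.
apply: isomorphic_is_zero (unit_isomorphic a) _.
exact/tens_is_zero/(isomorphic_is_zero zu).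
Qed.

Lemma exists_disjoint_prime S :
  tens_multiplicative S -> (forall z, is_zero z -> ~ S z) ->
  exists P, Spc K P /\ P `&` S = set0.
Proof.
move=> Smul S0.
have [|P [Pmax _]] := @exists_maximal_disjoint_thick S (@is_zero K).
  split; first exact: zero_thick.
  by apply/seteqP; split=> // z [/S0].
by exists P; split; [apply: maximal_disjoint_prime Pmax | case: Pmax => -[]].
Qed.

End Thick.

Theorem proposition2p3 (K : tt_category) (K_nonzero : nonzero_category K) :
  (forall S : set K, tens_multiplicative S ->
     (forall z : K, is_zero z -> ~ S z) ->
     exists P : set K, Spc K P /\ P `&` S = set0) /\
  (forall J : set K, proper_thick_ideal J ->
     exists M : set K, maximal_thick_ideal M /\ J `<=` M) /\
  (forall M : set K, maximal_thick_ideal M -> prime_thick_ideal M) /\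
  (Spc K !=set0).
Proof.
split; first exact: exists_disjoint_prime.
split.
  move=> J /proper_thick_idealE /exists_maximal_disjoint_thick [M [Mmax JM]].
  by exists M; split=> //; apply/maximal_thick_idealE.
split.
  move=> M /maximal_thick_idealE.
  exact/maximal_disjoint_prime/unit_class_multiplicative.
have [|P [PK _]] := exists_disjoint_prime (unit_class_multiplicative K).
  by move=> z; apply: unit_class_nonzero.
by exists P.
Qed.
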